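(* Let $X$ be a completely regular space with a replete admissible family $\mathcal{O}$ of open coverings, let $S$ be a topological semigroup acting on $X$ with every map $\mu_s:X\to X$ continuous, and let $\mathcal{F}$ be a filter basis on the subsets of $S$. Let $\mathcal{A}\subset X$ be a nonempty set that is closed, compact, and invariant. If $\mathcal{A}$ is the global $\mathcal{F}$-attractor for $(S,X)$, then $\mathcal{A}$ is the global uniform $\mathcal{F}$-attractor for $(S,X)$. Conversely, suppose that for all $s\in S$ and $A\in\mathcal{F}$ there exists $B\in\mathcal{F}$ with $B\subset As$, and that $(S,X)$ is eventually compact and $\mathcal{F}$-asymptotically compact; if $\mathcal{A}$ is the global uniform $\mathcal{F}$-attractor for $(S,X)$, then $\mathcal{A}$ is the global $\mathcal{F}$-attractor for $(S,X)$.
   Context: Coverings. For coverings $\mathcal{U},\mathcal{V}$ of $X$: $\mathcal{V}\leqslant\mathcal{U}$ means $\mathcal{V}$ refines $\mathcal{U}$ (each member of $\mathcal{V}$ is contained in some member of $\mathcal{U}$); $\mathcal{V}\leqslant\frac12\mathcal{U}$ means that for all $V,V'\in\mathcal{V}$ with $V\cap V'\neq\emptyset$ there is $U\in\mathcal{U}$ with $V\cup V'\subset U$. The star of $Y\subset X$ is $\mathrm{St}[Y,\mathcal{U}]=\bigcup\{U\in\mathcal{U}:Y\cap U\neq\emptyset\}$, and $\mathrm{St}[x,\mathcal{U}]=\mathrm{St}[\{x\},\mathcal{U}]$. A family $\mathcal{O}$ of open coverings of $X$ is admissible if: (1) for each $\mathcal{U}\in\mathcal{O}$ there is $\mathcal{V}\in\mathcal{O}$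 with $\mathcal{V}\leqslant\frac12\mathcal{U}$; (2) if $Y\subset X$ is open and $K\subset Y$ is compact, there is $\mathcal{U}\in\mathcal{O}$ with $\mathrm{St}[K,\mathcal{U}]\subset Y$; (3) for $\mathcal{U},\mathcal{V}\in\mathcal{O}$ there is $\mathcal{W}\in\mathcal{O}$ with $\mathcal{W}\leqslant\mathcal{U}$ and $\mathcal{W}\leqslant\mathcal{V}$. It is replete if moreover $X=\bigcup_{\mathcal{U}\in\mathcal{O}}\mathrm{St}[x,\mathcal{U}]$ for every $x\in X$, and for $\mathcal{U},\mathcal{V}\in\mathcal{O}$ there is $\mathcal{W}\in\mathcal{O}$ with $\mathcal{U}\leqslant\frac12\mathcal{W}$ and $\mathcal{V}\leqslant\frac12\mathcal{W}$. (Completely regular spaces are not assumed Hausdorff.) A nonempty $Y\subset X$ is bounded if there is $\mathcal{U}\in\mathcal{O}$ with $y\in\mathrm{St}[x,\mathcal{U}]$ for all $x,y\in Y$. A net is bounded if its set of values is bounded. Actions. An action of $S$ on $X$ is a map $\mu:S\times X\to X$, $\mu(s,x)=sx$, with $s(tx)=(st)x$; $\mu_s(x)=sx$. For $A\subset S$, $Y\subset X$, $AY=\bigcup_{s\in A}\mu_s(Y)$. $Y$ is invariant if $sY=Y$ for every $s\in S$. A filter basis $\mathcal{F}$ on the subsets of $S$ is a nonempty family of subsets with $\emptyset\notin\mathcal{F}$ and such that for $A,B\in\mathcal{F}$ there is $C\in\mathcal{F}$ with $C\subset A\cap B$. A net $(t_\lambda)$ in $S$ satisfies $t_\lambda\to_{\mathcal{F}}\infty$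 if for each $A\in\mathcal{F}$ there is $\lambda_0$ with $t_\lambda\in A$ for all $\lambda\geq\lambda_0$. The forward $\mathcal{F}$-prolongational limit set $J(x,\mathcal{F})$ of $x\in X$ is the set of $y\in X$ for which there are nets $(t_\lambda)$ in $S$ and $(x_\lambda)$ in $X$ with $t_\lambda\to_{\mathcal{F}}\infty$, $x_\lambda\to x$ and $t_\lambda x_\lambda\to y$; $J(Y,\mathcal{F})=\bigcup_{x\in Y}J(x,\mathcal{F})$. $Y\subset X$ attracts $Z\subset X$ if for each $\mathcal{U}\in\mathcal{O}$ there is $A\in\mathcal{F}$ with $AZ\subset\mathrm{St}[Y,\mathcal{U}]$. $(S,X)$ is: eventually compact if there is $t\in S$ such that $\mu_t(Y)$ is relatively compact (has compact closure) for every bounded $Y\subset X$; $\mathcal{F}$-asymptotically compact if for every bounded net $(x_\lambda)$ in $X$ and every net $(t_\lambda)$ in $S$ (same index set) with $t_\lambda\to_{\mathcal{F}}\infty$, the net $(t_\lambda x_\lambda)$ has a convergent subnet. A global $\mathcal{F}$-attractor is a subset of $X$ that is nonempty, closed, compact, invariant, and attracts every bounded subset of $X$. A global uniform $\mathcal{F}$-attractor is a compact invariant set $\mathcal{A}$ such that $J(x,\mathcal{F})\neq\emptyset$ for every $x\in X$ and $J(X,\mathcal{F})\subset\mathcal{A}$. Saying that $\mathcal{A}$ ''is the'' global (uniform) $\mathcal{F}$-attractor means that it satisfies the corresponding definition. *)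

(* Defs.v *)
From HB Require Import structures.
From mathcomp Require Import all_boot all_algebra all_classical.
From mathcomp Require Import topology normedtype.

Set Implicit Arguments.
Unset Strict Implicit.
Unset Printing Implicit Defensive.

Local Open Scope classical_set_scope.

(* Continuity of the product is joint; no separation axiom is imposed. *)
HB.mixin Record Semigroup_isTopological S of Topological S & Semigroup S := {
  mulg_continuous : continuous (fun st : S * S => (st.1 * st.2)%g)
}.

#[short(type="topologicalSemigroupType")]
HB.structure Definition TopologicalSemigroup :=
  {S of Topological S & Semigroup S & Semigroup_isTopological S}.

(** Nets *)

Record directedSet := DirectedSet {
  dcarrier :> Type;
  dle : dcarrier -> dcarrier -> Prop;
  dle_refl : forall i, dle i i;
  dle_trans : forall i j k, dle i j -> dle j k -> dle i k;
  dle_directed : forall i j, exists k, dle i k /\ dle j k;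
  dcarrier_inhabited : inhabited dcarrier }.

(* The filter of eventual subsets of L: a net x : L -> T converges to p in the
   usual sense exactly when x @ tails L --> p. *)
Definition tails (L : directedSet) : set_system L :=
  [set P | exists i0, forall i, dle i0 i -> P i].
Arguments tails : clear implicits.

(* Subnets in the sense of Kelley: x \o h is a subnet of x. *)
Definition subnet_map (M L : directedSet) (h : M -> L) : Prop :=
  forall i0 : L, exists j0 : M, forall j, dle j0 j -> dle i0 (h j).

Definition has_convergent_subnet (X : topologicalType) (L : directedSet)
    (x : L -> X) : Prop :=
  exists (M : directedSet) (h : M -> L) (p : X),
    subnet_map h /\ (x \o h) @ tails M --> p.

(** Coverings *)

Definition open_covering (X : topologicalType) (C : set (set X)) : Prop :=
  (forall U, C U -> open U) /\ \bigcup_(U in C) U = setT.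

Definition refines (X : Type) (D C : set (set X)) : Prop :=
  forall V, D V -> exists2 U, C U & V `<=` U.

Definition half_refines (X : Type) (D C : set (set X)) : Prop :=
  forall V V', D V -> D V' -> V `&` V' !=set0 ->
  exists2 U, C U & V `|` V' `<=` U.

Definition star (X : Type) (Y : set X) (C : set (set X)) : set X :=
  \bigcup_(U in [set U | C U /\ Y `&` U !=set0]) U.

Record admissible (X : topologicalType) (O : set (set (set X))) : Prop :=
  Admissible {
    admissible_open_covering : forall C, O C -> open_covering C;
    admissible_half : forall C, O C -> exists2 D, O D & half_refines D C;
    admissible_compact : forall Y K : set X, open Y -> compact K -> K `<=` Y ->
      exists2 C, O C & star K C `<=` Y;
    admissible_common : forall C D, O C -> O D ->
      exists2 W, O W & refines W C /\ refines W D }.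

Record replete (X : topologicalType) (O : set (set (set X))) : Prop :=
  Replete {
    replete_admissible : admissible O;
    replete_exhaust : forall x : X, \bigcup_(C in O) star [set x] C = setT;
    replete_common : forall C D, O C -> O D ->
      exists2 W, O W & half_refines C W /\ half_refines D W }.

Definition cover_bounded (X : Type) (O : set (set (set X))) (Y : set X) : Prop :=
  Y !=set0 /\
  exists2 C, O C & forall x y, Y x -> Y y -> star [set x] C y.

(** Semigroup actions *)

Definition semigroup_action (S : semigroupType) (X : Type) (mu : S -> X -> X)
    : Prop :=
  forall s t x, mu s (mu t x) = mu (s * t)%g x.

Definition act_set (S X : Type) (mu : S -> X -> X) (A : set S) (Y : set X)
    : set X :=
  \bigcup_(s in A) (mu s @` Y).

Definition invariant_set (S X : Type) (mu : S -> X -> X) (Y : set X) : Prop :=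
  forall s, mu s @` Y = Y.

Definition filter_basis (S : Type) (F : set (set S)) : Prop :=
  [/\ F !=set0, ~ F set0
    & forall A B, F A -> F B -> exists2 C, F C & C `<=` A `&` B].

Definition tends_to_infty (S : Type) (F : set (set S)) (L : directedSet)
    (t : L -> S) : Prop :=
  forall A, F A -> \forall i \near tails L, A (t i).

Definition prolongational_limit (S : Type) (X : topologicalType)
    (mu : S -> X -> X) (F : set (set S)) (x : X) : set X :=
  [set y | exists (L : directedSet) (t : L -> S) (x_ : L -> X),
    [/\ tends_to_infty F t, x_ @ tails L --> x
      & (fun i => mu (t i) (x_ i)) @ tails L --> y]].

Definition prolongational_limit_set (S : Type) (X : topologicalType)
    (mu : S -> X -> X) (F : set (set S)) (Y : set X) : set X :=
  \bigcup_(x in Y) prolongational_limit mu F x.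

Definition attracts (S X : Type) (O : set (set (set X))) (mu : S -> X -> X)
    (F : set (set S)) (Y Z : set X) : Prop :=
  forall C, O C -> exists2 A, F A & act_set mu A Z `<=` star Y C.

Definition eventually_compact (S : Type) (X : topologicalType)
    (O : set (set (set X))) (mu : S -> X -> X) : Prop :=
  exists t : S, forall Y, cover_bounded O Y -> compact (closure (mu t @` Y)).

Definition asymptotically_compact (S : Type) (X : topologicalType)
    (O : set (set (set X))) (mu : S -> X -> X) (F : set (set S)) : Prop :=
  forall (L : directedSet) (x : L -> X) (t : L -> S),
    cover_bounded O (range x) -> tends_to_infty F t ->
    has_convergent_subnet (fun i => mu (t i) (x i)).

Definition global_attractor (S : Type) (X : topologicalType)
    (O : set (set (set X))) (mu : S -> X -> X) (F : set (set S)) (A : set X)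
    : Prop :=
  [/\ A !=set0, closed A, compact A, invariant_set mu A
    & forall Y, cover_bounded O Y -> attracts O mu F A Y].

Definition global_uniform_attractor (S : Type) (X : topologicalType)
    (mu : S -> X -> X) (F : set (set S)) (A : set X) : Prop :=
  [/\ compact A, invariant_set mu A,
      forall x, prolongational_limit mu F x !=set0
    & prolongational_limit_set mu F setT `<=` A].

(* Main.v *)
(* Everything goes through the net-free description of J(x, F): y is in J(x, F)
   iff for all neighbourhoods U of x, V of y and all B in F some t in B maps a
   point of U into V.  If A is the global attractor, the images of x cluster at
   a point of the compact set A; and since each point has a bounded
   neighbourhood, attracted by A, no point outside A lies in J.  Conversely, if
   A does not attract a bounded set Y, factor the bad elements of S as b * t,
   with mu t Y relatively compact: a limit of bad values b (t y) lies in J(x, F)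
   for a cluster point x of the points t y, yet outside a neighbourhood of A. *)
Require Import Defs.
From mathcomp Require Import all_boot all_algebra all_classical.
From mathcomp Require Import topology normedtype.

Set Implicit Arguments.
Unset Strict Implicit.
Unset Printing Implicit Defensive.

Local Open Scope classical_set_scope.


Section Stars.
Context {X : topologicalType} (O : set (set (set X))).

Lemma star_open C (Y : set X) : open_covering C -> open (star Y C).
Proof. by move=> [Cop _]; apply: bigcup_open => U [/Cop]. Qed.

Lemma sub_star C (Y : set X) : open_covering C -> Y `<=` star Y C.
Proof.
move=> [_ Ccov] y Yy; have [U CU Uy] : (\bigcup_(U in C) U) y by rewrite Ccov.
by exists U => //; split=> //; exists y.
Qed.

Lemma star_nbhs C (x : X) : open_covering C -> nbhs x (star [set x] C).
Proof.
by move=> Ccov; apply: open_nbhs_nbhs; split; [exact: star_open|exact: sub_star].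
Qed.

(** Members of [D] meeting [Y] and [Z] and sharing a point lie in one member of [C], which then
    meets both [Y] and [Z]. *)
Lemma half_refines_star_disjoint C D (Y Z : set X) :
  half_refines D C -> star Y C `&` Z `<=` set0 ->
  star Y D `&` star Z D `<=` set0.
Proof.
move=> DC YZ u [[V [DV [y [Yy Vy]]] Vu] [V' [DV' [z [Zz V'z]]] V'u]].
have [|U CU VU] := DC V V' DV DV'; first by exists u.
apply: (YZ z); split => //; exists U; last by apply: VU; right.
by split=> //; exists y; split=> //; apply: VU; left.
Qed.

(** Two members of [C] through [x] lie together in one member of [W], so [W] joins any two points of
    the star. *)
Lemma half_refines_star_bounded C W (x : X) :
  open_covering C -> O W -> half_refines C W -> cover_bounded O (star [set x] C).
Proof.
move=> Ccov OW CW; split; first by exists x; exact: sub_star.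
exists W => // u v [U [CU [_ [-> Ux]]] Uu] [V [CV [_ [-> Vx]]] Vv].
have [|Q WQ UVQ] := CW U V CU CV; first by exists x.
exists Q; last by apply: UVQ; right.
by split=> //; exists u; split=> //; apply: UVQ; left.
Qed.

Lemma replete_bounded_nbhs (x : X) : replete O ->
  exists2 Z, nbhs x Z & cover_bounded O Z.
Proof.
move=> [adm exh com].
have [C OC _] : (\bigcup_(C in O) star [set x] C) x by rewrite exh.
have [W OW [CW _]] := com _ _ OC OC.
have Ccov := admissible_open_covering adm OC.
exists (star [set x] C); first exact: star_nbhs.
exact: half_refines_star_bounded CW.
Qed.

Lemma cover_bounded_sub (Y Z : set X) :
  Z `<=` Y -> Z !=set0 -> cover_bounded O Y -> cover_bounded O Z.
Proof.
move=> ZY Z0 [_ [C OC YC]]; split=> //.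
by exists C => // x y /ZY Yx /ZY Yy; exact: YC.
Qed.

(** If no point of [K] were a cluster point, compactness would give one [Q] in [G] whose closure
    misses [K]; some star of [K] would then avoid [Q], although both belong to [G]. *)
Lemma cluster_compact_stars (K : set X) (G : set_system X) :
  admissible O -> ProperFilter G -> compact K ->
  (forall C, O C -> G (star K C)) -> K `&` cluster G !=set0.
Proof.
move=> adm PG cK GK; apply: contrapT => noK.
have /compact_near_coveringP ncK := cK.
(* Taking small members of [G] as parameters makes the choice of [Q] uniform over [K]. *)
have [x Kx|] := ncK _ (powerset_filter_from G) (fun Q x => ~ closure Q x) _.
  have [Q [N [GQ Nx QN]]] : exists Q N, [/\ G Q, nbhs x N & Q `&` N = set0].
    apply: contrapT => nQN; apply: noK; exists x; split=> // Q N GQ Nx.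
    by apply/set0P/eqP => QN; apply: nQN; exists Q, N.
  exists (N°, [set W | W `<=` Q]).
    by split; [exact: nbhs_interior | exact: small_set_sub].
  move=> [y W] /= [Ny WQ] /(_ _ Ny) [z [/WQ Qz Nz]].
  by have : (Q `&` N) z by []; rewrite QN.
move=> M [MG Msub [Q MQ]] /(_ _ MQ) KQ.
have [C OC KC] : exists2 C, O C & star K C `<=` ~` closure Q.
  apply: admissible_compact => //.
  by rewrite openC; exact: closed_closure.
have [z [/KC nQz Qz]] := filter_ex (filterI (GK C OC) (MG _ MQ)).
by apply: nQz; exact: subset_closure.
Qed.

End Stars.

Global Instance tails_filter (L : directedSet) : ProperFilter (tails L).
Proof.
apply: Build_ProperFilter_ex => [P [i iP]|].
  by exists i; apply: iP; exact: dle_refl.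
split.
- by have [i] := dcarrier_inhabited L; exists i.
- move=> P Q [i iP] [j jQ]; have [k [ik jk]] := dle_directed i j.
  by exists k => l kl; split; [apply: iP|apply: jQ]; apply: dle_trans kl.
- by move=> P Q PQ [i iP]; exists i => l /iP /PQ.
Qed.

(** Choose a point in each [B i] and order indices by reverse inclusion of the sets [B i]. The first
    conclusion keeps, at every index, the conditions common to all [B i]. *)
Lemma filter_from_net (I T : Type) (D : set I) (B : I -> set T) :
  D !=set0 ->
  (forall i j, D i -> D j -> exists2 k, D k & B k `<=` B i `&` B j) ->
  (forall i, D i -> B i !=set0) ->
  exists (L : directedSet) (x : L -> T),
    (forall l, exists2 i, D i & B i (x l)) /\
    forall i, D i -> \forall l \near tails L, B i (x l).
Proof.
move=> [i0 Di0] dir ne.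
pose le (i j : {i | D i}) := B (sval j) `<=` B (sval i).
have le_refl i : le i i by [].
have le_trans i j k : le i j -> le j k -> le i k.
  by move=> ij jk; exact: subset_trans jk ij.
have le_dir i j : exists k, le i k /\ le j k.
  have [k Dk kij] := dir _ _ (svalP i) (svalP j).
  by exists (exist _ k Dk); split=> z /kij[].
have [x Bx] := choice (fun i : {i | D i} => ne _ (svalP i)).
exists (DirectedSet le_refl le_trans le_dir (inhabits (exist _ i0 Di0))), x.
split=> [l|i Di]; first by exists (sval l); [exact: svalP|].
by exists (exist _ i Di) => j; apply; exact: Bx.
Qed.

Section Prolongation.
Context {S : Type} {X : topologicalType} (mu : S -> X -> X) (F : set (set S)).
Hypothesis F_basis : filter_basis F.

Let basis_dir B C : F B -> F C -> exists2 D, F D & D `<=` B `&` C.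
Proof. by case: F_basis => _ _; apply. Qed.

Let basis_ne B : F B -> B !=set0.
Proof.
by case: F_basis => _ F0 _ FB; apply/set0P/eqP => B0; apply: F0; rewrite -B0.
Qed.

Lemma prolongational_limitP x y :
  prolongational_limit mu F x y <->
  forall U V B, nbhs x U -> nbhs y V -> F B ->
    exists t z, [/\ B t, U z & V (mu t z)].
Proof.
split=> [[L [t [z [tF zx tzy]]]] U V B xU yV FB|meet].
  have [i [Bt [Uz Vtz]]] :=
    @filter_ex _ (tails L) _ _ (filterI (tF B FB) (filterI (zx U xU : tails L _)
      (tzy V yV : tails L _))).
  by exists (t i), (z i).
(* The net is indexed by triples (U, V, B); [setT] and [B0] fill the slots that a given limit does
   not concern. *)
have [B0 FB0] : F !=set0 by case: F_basis.
pose D := [set p : set X * set X * set S |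
  [/\ nbhs x p.1.1, nbhs y p.1.2 & F p.2]].
pose E p := [set tz : S * X | [/\ p.2 tz.1, p.1.1 tz.2 & p.1.2 (mu tz.1 tz.2)]].
have [|p q [pU pV pB] [qU qV qB]|p [pU pV pB]|L [tz [_ Etz]]] :=
    @filter_from_net _ _ D E.
- by exists (setT, setT, B0); split=> //; exact: filterT.
- have [B FB Bpq] := basis_dir pB qB.
  exists (p.1.1 `&` q.1.1, p.1.2 `&` q.1.2, B).
    by split=> //; exact: filterI.
  by move=> [t z] [/= /Bpq[? ?] [? ?] [? ?]].
- by have [t [z tz]] := meet _ _ _ pU pV pB; exists (t, z).
exists L, (fst \o tz), (snd \o tz); split=> [B FB|U xU|V yV].
- have /Etz[i iE] : D (setT, setT, B) by split=> //; exact: filterT.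
  by exists i => j /iE[].
- have /Etz[i iE] : D (U, setT, B0) by split=> //; exact: filterT.
  by exists i => j /iE[].
- have /Etz[i iE] : D (setT, V, B0) by split=> //; exact: filterT.
  by exists i => j /iE[].
Qed.

Lemma attracts_prolongational_limit_neq0 O (A : set X) x :
  admissible O -> compact A -> attracts O mu F A [set x] ->
  A `&` prolongational_limit mu F x !=set0.
Proof.
move=> adm cA att.
have FF : ProperFilter (filter_from F id).
  apply: filter_from_proper => //; apply: filter_from_filter => //.
  by case: F_basis.
have [C OC|y [Ay clusy]] :=
    @cluster_compact_stars X O A ((mu^~ x) @ filter_from F id) adm _ cA.
  have [B FB Bsub] := att C OC.
  by exists B => // t Bt; apply: Bsub; exists t => //; exists x.
exists y; split=> //; apply/prolongational_limitP => U V B xU yV FB.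
have [|_ [[t Bt <-] Vtx]] := clusy [set mu t x | t in B] V _ yV.
  by exists B => // t Bt; exists t.
by exists t, x; split=> //; exact: nbhs_singleton.
Qed.

(** A point [y] outside [A] and the set [A] have disjoint stars for a fine enough [D], while
    attraction of [Z] puts values [mu t z] near [y] into the star of [A]. *)
Lemma attracts_prolongational_limit_sub O (A Z : set X) x :
  admissible O -> closed A -> nbhs x Z -> attracts O mu F A Z ->
  prolongational_limit mu F x `<=` A.
Proof.
move=> adm clA xZ att y /prolongational_limitP Jy; apply: contrapT => nAy.
have [C OC CA] : exists2 C, O C & star [set y] C `<=` ~` A.
  by apply: admissible_compact; rewrite ?openC//; [exact: compact_set1|move=> _ ->].
have [D OD DC] := admissible_half adm OC.
have [B FB Bsub] := att D OD.
have Dcov := admissible_open_covering adm OD.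
have [t [z [Bt Zz tzy]]] := Jy _ _ _ xZ (star_nbhs y Dcov) FB.
apply: (half_refines_star_disjoint DC (Y := [set y]) (Z := A)).
  by move=> u [/CA].
by split; [exact: tzy|apply: Bsub; exists t => //; exists z].
Qed.

End Prolongation.

Lemma prolongational_limit_attracts (S : semigroupType) (X : topologicalType)
    (O : set (set (set X))) (mu : S -> X -> X) (F : set (set S)) (A Y : set X) :
  admissible O -> semigroup_action mu -> filter_basis F ->
  (forall (s : S) (B : set S), F B ->
      exists2 C, F C & C `<=` [set (b * s)%g | b in B]) ->
  eventually_compact O mu -> asymptotically_compact O mu F ->
  prolongational_limit_set mu F setT `<=` A ->
  cover_bounded O Y -> attracts O mu F A Y.
Proof.
move=> adm act Fb Fdiv [t tcpt] acpt JA Ybd C OC; apply: contrapT => natt.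
have Ccov := admissible_open_covering adm OC.
have [F0 _ Fdir] := Fb.
(* Both [b] and [b * t] are kept in [B]: asymptotic compactness is applied along [b * t], and
   membership in J along [b]. *)
pose E B := [set bx : S * X | [/\ B bx.1, B (bx.1 * t)%g, Y bx.2
  & ~ star A C (mu (bx.1 * t)%g bx.2)]].
have [B B' FB FB'|B FB|L [bx [Ebx bxE]]] := filter_from_net (B := E) F0.
- have [B2 FB2 B2sub] := Fdir B B' FB FB'; exists B2 => //.
  by move=> [b x] [/= /B2sub[? ?] /B2sub[? ?] ? ?].
(* A bad element of [B2] lies in [B] and equals [b * t] with [b] in [B]. *)
- have [B1 FB1 B1t] := Fdiv t B FB; have [B2 FB2 B2sub] := Fdir _ _ FB FB1.
  apply: contrapT => nE; apply: natt; exists B2 => // _ [s B2s [x Yx <-]].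
  have [Bs /B1t[b Bb bts]] := B2sub s B2s.
  apply: contrapT => nst; apply: nE.
  by exists (b, x); split=> //=; rewrite bts.
pose b i := (bx i).1; pose x i := (bx i).2.
have Yx i : Y (x i) by have [B FB []] := Ebx i.
have b_infty : tends_to_infty F b.
  by move=> B /bxE[i iE]; exists i => j /iE[].
have bt_infty : tends_to_infty F (fun i => b i * t)%g.
  by move=> B /bxE[i iE]; exists i => j /iE[].
have xbd : cover_bounded O (range x).
  apply: cover_bounded_sub Ybd; first by move=> _ [i _ <-].
  by have [i] := dcarrier_inhabited L; exists (x i), i.
have [M [h [p [hsub btxp]]]] := acpt L x _ xbd bt_infty.
have [|q [_ clusq]] := tcpt Y Ybd ((fun j => mu t (x (h j))) @ tails M) _.
  have [j] := dcarrier_inhabited M.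
  by exists j => k _; apply: subset_closure; exists (x (h k)).
have Ap : A p.
  apply: JA; exists q => //; apply/(prolongational_limitP mu Fb) => U V B qU pV FB.
  have [i0 i0B] := b_infty B FB; have [j0 j0h] := hsub i0.
  have hB : \forall j \near tails M, B (b (h j)).
    by exists j0 => j /j0h /i0B.
  (* No further subnet is needed: clustering at [q] gives one index at which all three conditions
     hold. *)
  have [|z [[j [Bj Vj] <-] Uz]] := clusq [set mu t (x (h j)) | j in
      [set j | B (b (h j)) /\ V (mu (b (h j) * t)%g (x (h j)))]] U _ qU.
    apply: (filterS _ (filterI hB (btxp V pV : tails M _))) => j BVj.
    by exists j.
  by exists (b (h j)), (mu t (x (h j))); rewrite act.
(* The star of [A] is a neighbourhood of [p], yet every value of the net avoids it. *)
have stp : nbhs p (star A C).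
  by apply: open_nbhs_nbhs; split; [exact: star_open|exact: sub_star].
have [j stj] := filter_ex (btxp _ stp : tails M _).
by have [B FB []] := Ebx (h j).
Qed.

Theorem theorem6 (X : topologicalType) (S : topologicalSemigroupType)
    (O : set (set (set X))) (mu : S -> X -> X) (F : set (set S)) (A : set X)
    (X_creg : completely_regular_space X) (O_replete : replete O)
    (mu_action : semigroup_action mu) (mu_cont : forall s, continuous (mu s))
    (F_basis : filter_basis F)
    (A_neq0 : A !=set0) (A_closed : closed A) (A_compact : compact A)
    (A_invariant : invariant_set mu A) :
  (global_attractor O mu F A -> global_uniform_attractor mu F A) /\
  ((forall (s : S) (B : set S), F B ->
      exists2 C, F C & C `<=` [set (b * s)%g | b in B]) ->
   eventually_compact O mu -> asymptotically_compact O mu F ->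
   global_uniform_attractor mu F A -> global_attractor O mu F A).
Proof.
have adm := replete_admissible O_replete.
split=> [[_ _ _ _ att]|Fdiv ecpt acpt [_ _ _ JA]].
  (* Nonemptiness uses attraction of [x] alone; inclusion in [A] uses a whole neighbourhood, since
     the moved points only tend to [x]. *)
  split=> // [x|y [x _]].
    have [Z xZ Zbd] := replete_bounded_nbhs x O_replete.
    have xbd : cover_bounded O [set x].
      apply: cover_bounded_sub Zbd; last by exists x.
      by move=> _ ->; exact: nbhs_singleton.
    have [y [_ Jy]] :=
      attracts_prolongational_limit_neq0 F_basis adm A_compact (att _ xbd).
    by exists y.
  have [Z xZ Zbd] := replete_bounded_nbhs x O_replete.
  exact: (attracts_prolongational_limit_sub F_basis adm A_closed xZ (att Z Zbd)).
split=> // Y Ybd.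
exact: prolongational_limit_attracts Ybd.
Qed.
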